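(* For every integer $n\ge 0$ let $r_n := R(n,n)$ be the resistance, on the infinite triangular lattice with unit resistors, between the origin and the vertex with coordinates $(n,n)$, i.e. $$r_n=\frac{2}{\pi}\int_0^{\pi/2}\frac{\sin^2(nx)}{\sin(x)\sqrt{4-\cos^2(x)}}\,dx ,$$ and define $r_{-1}:=0$ for convenience. Then the following hold. (1) $r_0=0$, $r_1=1/3$, and for all $n\ge 2$, $$r_n=\frac{15n-22}{n-1}\,r_{n-1}-\frac{15n-23}{n-1}\,r_{n-2}+\frac{n-2}{n-1}\,r_{n-3}-\frac{4\sqrt3}{\pi(n-1)} .$$ Consequently $r_n$ is available exactly from finitely many sums, ratios and products of rational numbers and a single multiplication by the irrational number $\sqrt3/\pi$; that is, for every $n\geq 0$ there are rational numbers $a_n,b_n$, computable by rational recurrences, with $r_n=a_n+b_n\,\frac{\sqrt3}{\pi}$. (2) For $n\ge 1$ put $$H(n):={}_3F_2\!\left(\tfrac12,\,-n+1,\,n+1;\,1,\,\tfrac32;\,-3\right).$$ Then $H(n)\in\mathbb{Q}$ for all $n\geq 1$, and for all $n\ge 0$, $$r_n=\frac{n}{3}H(n)-\frac{4\sqrt3}{\pi}\sum_{m=1}^{n}(n-m)\,H(n-m)\,H(m),$$ where the product $0\cdot H(0)$ is read as $0$. (3) As $n\to+\infty$, $$r_n=\frac{1}{\sqrt3\,\pi}\log(n)+\frac{\gamma+\log(2\sqrt3)}{\sqrt3\,\pi}+O(1/n),$$ where $\gamma$ is the Euler–Mascheroni constant.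
   Context: The infinite triangular lattice is the graph on the points $n u+m v$, $(n,m)\in\mathbb{Z}^2$, where $u,v$ are unit vectors of the plane at an angle of $120^\circ$, two points being adjacent when they are at Euclidean distance $1$ (so every vertex has $6$ neighbours); the point $nu+mv$ has coordinates $(n,m)$. Every edge is a resistor of $1$ Ohm, and $R(n,m)$ denotes the resistance between the origin and the point $(n,m)$. The integral expression for $R(n,n)$ displayed in the claim is a known formula from the literature and may be taken as the definition of $r_n$. The generalized hypergeometric function is ${}_3F_2(a_1,a_2,a_3;b_1,b_2;z)=\sum_{k\ge0}\frac{(a_1)_k(a_2)_k(a_3)_k}{(b_1)_k(b_2)_k}\frac{z^k}{k!}$, where $(a)_k=a(a+1)\cdots(a+k-1)$ and $(a)_0=1$. For $n\ge1$ the series defining $H(n)$ terminates, since $-n+1$ is a nonpositive integer. *)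

(* Defs.v *)
From Stdlib Require Import Reals ZArith QArith Qreals.
From Coquelicot Require Import Coquelicot.
Open Scope R_scope.

(* [r k] is the resistance R(k,k) of the triangular lattice for k >= 0, given by
   its known integral expression.  The integrand extends continuously to x = 0,
   so the value it takes there does not affect the Riemann integral.
   [r (-1) = 0] is a convention; values at k < -1 are irrelevant. *)
Definition r (k : Z) : R :=
  if (0 <=? k)%Z then
    2 / PI * RInt (fun x => (sin (IZR k * x))^2 / (sin x * sqrt (4 - (cos x)^2)))
                  0 (PI / 2)
  else 0.

Fixpoint pochhammer (a : R) (k : nat) : R :=
  match k with
  | O => 1
  | S k' => pochhammer a k' * (a + INR k')
  end.

Definition hyp3F2 (a1 a2 a3 b1 b2 z : R) : R :=
  Series (fun k : nat =>
    (pochhammer a1 k * pochhammer a2 k * pochhammer a3 k)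
      / (pochhammer b1 k * pochhammer b2 k)
      * (z ^ k / INR (fact k))).

(* The series terminates for n >= 1.  For n = 0 it diverges and [H 0] is a
   meaningless real number, so that [0 * H 0] is 0. *)
Definition H (n : nat) : R :=
  hyp3F2 (1 / 2) (- INR n + 1) (INR n + 1) 1 (3 / 2) (-3).

Definition euler_gamma : R :=
  real (Lim_seq (fun n : nat => sum_n_m (fun k : nat => / INR k) 1 n - ln (INR n))).

Definition is_bigO (u v : nat -> R) : Prop :=
  exists C : R, eventually (fun n : nat => Rabs (u n) <= C * Rabs (v n)).

(* Main.v *)
Require Import Defs.
From Stdlib Require Import Reals ZArith QArith Qreals.
From Coquelicot Require Import Coquelicot.
From Stdlib Require Import Lra Lia FunctionalExtensionality.
Open Scope R_scope.

(** Since [sin ((n+1)x)^2 - sin (nx)^2 = sin x * sin ((2n+1)x)], the factor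
    [sin x] cancels in [r (n+1) - r n], which is the increment
    [e_n = 2/pi * int_0^(pi/2) sin ((2n+1)x) / sqrt (4 - cos^2 x) dx].
    Integrating the derivative of [cos ((2n+1)x) * sqrt (4 - cos^2 x)] relates
    three consecutive increments ([increment_recurrence]):
      [(n+1) e_(n+1) - 7 (2n+1) e_n + n e_(n-1) = - 4 sqrt 3 / pi].
    Written in terms of [r], this is the stated recurrence; its coefficients are
    rational, so the rational multiples of [1] and of [sqrt 3 / pi] can be
    followed separately ([r_rational_combination]).

    The homogeneous form of that relation is the Legendre recurrence at the
    point 7.  The value [P_j] of the j-th Legendre polynomial at 7 is a sum over
    k of explicit products, and these products satisfy the recurrence up to a
    telescoping term ([legendre_coef_recurrence]); summed over [j < n] they
    become [n] times the terms of the hypergeometric series, so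
    [n H(n) = P_0 + ... + P_(n-1)].  Let [P(z)] and [h(z)] be the formal series
    with coefficients [P_j] and [H(m)], [m >= 1], and [c = 4 sqrt 3 / pi].
    Then [P(z)^2 (1 - 14 z + z^2) = 1] ([mul_disc_legendre_sqr]), and
    [z h'(z) = z P(z) / (1 - z)], so applying the recurrence operator to
    [h(z) P(z)] yields [z / (1 - z)], whose coefficients beyond the constant one
    are all 1.  Hence [P(z) (1/3 - c h(z))] solves the
    inhomogeneous recurrence and has the right constant term, so it is the
    generating series of the increments ([increment_closed_form]); summation of
    the increments gives the convolution formula ([r_convolution]).

    For the asymptotics, [1 / sqrt (4 - cos^2 x) = 1 / sqrt 3 + sin x * g(x)]
    with [g] smooth.  The first term contributes the sum of the odd reciprocals
    [1 + 1/3 + ... + 1/(2n-1) = h_(2n) - h_n / 2] (harmonic numbers), known up to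
    [O(1/n)] through the Euler constant.  The second contributes the integral of
    [sin (nx)^2 g(x)], which differs from half the integral of [g] by an
    oscillating integral that is [O(1/n)] by parts; the integral of [g] is
    elementary and equals [ln (sqrt 3 / 2) / sqrt 3]. *)

(** * Calculus preliminaries *)

(** Equalities stated in the carrier of a Coquelicot structure are invisible to
    [ring] and [field] until their type is restored to [R]. *)
Ltac as_R := match goal with |- @eq _ ?a ?b => change (@eq R a b) end.

Lemma is_RInt_add (f g : R -> R) a b u v :
  is_RInt f a b u -> is_RInt g a b v -> is_RInt (fun x => f x + g x) a b (u + v).
Proof. apply (is_RInt_plus (V := R_NormedModule)). Qed.

Lemma is_RInt_mul (f : R -> R) k a b u :
  is_RInt f a b u -> is_RInt (fun x => k * f x) a b (k * u).
Proof. apply (is_RInt_scal (V := R_NormedModule)). Qed.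

Lemma continuous_add (f g : R -> R) x :
  continuous f x -> continuous g x -> continuous (fun y => f y + g y) x.
Proof. apply (continuous_plus (V := R_NormedModule)). Qed.

Lemma continuous_mul (f : R -> R) k x :
  continuous f x -> continuous (fun y => k * f y) x.
Proof. intros. apply (continuous_scal_r (V := R_NormedModule)). auto. Qed.

Lemma continuous_prod (f h : R -> R) x :
  continuous f x -> continuous h x -> continuous (fun y => f y * h y) x.
Proof. apply (continuous_mult f h). Qed.

Lemma continuous_div (f g : R -> R) x :
  continuous f x -> continuous g x -> g x <> 0 -> continuous (fun y => f y / g y) x.
Proof.
  intros Hf Hg H0. apply (continuous_mult f (fun y => / g y)); auto.
  apply continuous_comp; auto. apply continuous_Rinv; auto.
Qed.

Lemma is_RInt_continuous (f : R -> R) a b :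
  (forall x : R, continuous f x) -> is_RInt f a b (RInt f a b).
Proof.
  intros Hf. apply (RInt_correct (V := R_CompleteNormedModule)).
  apply (ex_RInt_continuous (V := R_CompleteNormedModule)). auto.
Qed.

Lemma is_RInt_antiderivative (F f : R -> R) a b :
  (forall x : R, is_derive F x (f x)) -> (forall x : R, continuous f x) ->
  is_RInt f a b (F b - F a).
Proof. intros HF Hf. apply (is_RInt_derive F f); auto. Qed.

Lemma is_derive_sin_mul k x : is_derive (fun y => sin (k * y)) x (k * cos (k * x)).
Proof. auto_derive; auto; ring. Qed.

Lemma is_derive_cos_mul k x : is_derive (fun y => cos (k * y)) x (- k * sin (k * x)).
Proof. auto_derive; auto; ring. Qed.

Lemma continuous_sin_mul k x : continuous (fun y => sin (k * y)) x.
Proof. apply (ex_derive_continuous (fun y => sin (k * y))). eexists; apply is_derive_sin_mul. Qed.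

Lemma continuous_cos_mul k x : continuous (fun y => cos (k * y)) x.
Proof. apply (ex_derive_continuous (fun y => cos (k * y))). eexists; apply is_derive_cos_mul. Qed.

(** * The radical of the integrand *)

Lemma sqrt3_sqr : sqrt 3 * sqrt 3 = 3.
Proof. apply sqrt_sqrt. lra. Qed.

Lemma sqrt3_pos : 0 < sqrt 3.
Proof. apply sqrt_lt_R0. lra. Qed.

Definition radical (x : R) : R := sqrt (4 - (cos x)^2).

Lemma radicand_ge3 x : 3 <= 4 - (cos x)^2.
Proof. generalize (COS_bound x). intros. nra. Qed.

Lemma radical_pos x : 0 < radical x.
Proof. apply sqrt_lt_R0. generalize (radicand_ge3 x). lra. Qed.

Lemma radical_sqr x : radical x * radical x = 4 - (cos x)^2.
Proof. apply sqrt_sqrt. generalize (radicand_ge3 x). lra. Qed.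

Lemma is_derive_radical x : is_derive radical x (cos x * sin x / radical x).
Proof.
  unfold radical. generalize (radicand_ge3 x). intros.
  auto_derive. { lra. }
  fold (radical x). generalize (radical_pos x). intros.
  replace (4 + - (cos x * (cos x * 1))) with (4 - (cos x)^2) by ring.
  fold (radical x). field. lra.
Qed.

Lemma Derive_radical x : Derive radical x = cos x * sin x / radical x.
Proof. apply is_derive_unique, is_derive_radical. Qed.

Lemma ex_derive_radical x : ex_derive radical x.
Proof. eexists. apply is_derive_radical. Qed.

Lemma radical_0 : radical 0 = sqrt 3.
Proof. unfold radical. rewrite cos_0. f_equal. ring. Qed.

Lemma continuous_radical x : continuous radical x.
Proof. apply (ex_derive_continuous radical). apply ex_derive_radical. Qed.

Lemma continuous_sin_div_radical k x : continuous (fun y => sin (k * y) / radical y) x.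
Proof.
  apply continuous_div; [apply continuous_sin_mul|apply continuous_radical|].
  generalize (radical_pos x). lra.
Qed.

Lemma is_RInt_sin_div_radical k :
  is_RInt (fun x => sin (k * x) / radical x) 0 (PI / 2)
          (RInt (fun x => sin (k * x) / radical x) 0 (PI / 2)).
Proof.
  apply is_RInt_continuous. intros x. apply continuous_sin_div_radical.
Qed.

(** * The increments of r *)

Definition increment (j : nat) : R :=
  2 / PI * RInt (fun x => sin ((2 * INR j + 1) * x) / radical x) 0 (PI / 2).

Lemma sin_sqr_succ n x :
  sin ((n + 1) * x) ^ 2 = sin (n * x) ^ 2 + sin x * sin ((2 * n + 1) * x).
Proof.
  replace ((n + 1) * x) with (n * x + x) by ring.
  replace ((2 * n + 1) * x) with (n * x + (n * x + x)) by ring.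
  rewrite !sin_plus, cos_plus.
  generalize (sin2_cos2 x) (sin2_cos2 (n * x)). unfold Rsqr. nra.
Qed.

Definition integrand (n : nat) (x : R) : R :=
  (sin (INR n * x)) ^ 2 / (sin x * radical x).

Lemma integrand_0 x : integrand 0 x = 0.
Proof. unfold integrand. simpl INR. rewrite Rmult_0_l, sin_0. unfold Rdiv. ring. Qed.

(** Integrability of [integrand], singular in form at 0, is inherited from [n] to
    [n + 1]: the two differ by a continuous function away from 0. *)
Lemma is_RInt_integrand_succ n v :
  is_RInt (integrand n) 0 (PI / 2) v ->
  is_RInt (integrand (S n)) 0 (PI / 2)
     (v + RInt (fun x => sin ((2 * INR n + 1) * x) / radical x) 0 (PI / 2)).
Proof.
  intros Hv. generalize PI_RGT_0; intros Hpi.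
  apply is_RInt_ext with
    (fun x => integrand n x + sin ((2 * INR n + 1) * x) / radical x).
  - rewrite Rmin_left, Rmax_right by lra. intros x Hx.
    unfold integrand. rewrite S_INR, sin_sqr_succ.
    assert (0 < sin x) by (apply sin_gt_0; lra).
    generalize (radical_pos x). intros. as_R. field. lra.
  - apply is_RInt_add; auto. apply is_RInt_sin_div_radical.
Qed.

Lemma ex_RInt_integrand n : ex_RInt (integrand n) 0 (PI / 2).
Proof.
  induction n as [|n [v IH]].
  - exists (scal (PI / 2 - 0) 0). apply is_RInt_ext with (fun _ => 0).
    + intros. rewrite integrand_0. reflexivity.
    + apply (is_RInt_const (V := R_NormedModule)).
  - eexists. apply is_RInt_integrand_succ. eauto.
Qed.

Lemma r_nat n : r (Z.of_nat n) = 2 / PI * RInt (integrand n) 0 (PI / 2).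
Proof.
  unfold r. replace (0 <=? Z.of_nat n)%Z with true.
  - f_equal. apply RInt_ext. intros. unfold integrand, radical.
    rewrite <- INR_IZR_INZ. reflexivity.
  - symmetry. apply Z.leb_le. lia.
Qed.

Lemma r_zero : r 0 = 0.
Proof.
  change 0%Z with (Z.of_nat 0). rewrite r_nat.
  rewrite (RInt_ext _ (fun _ => 0)).
  - rewrite RInt_const. unfold scal; simpl; unfold mult; simpl. ring.
  - intros. rewrite integrand_0. reflexivity.
Qed.

Lemma r_succ n : r (Z.of_nat (S n)) = r (Z.of_nat n) + increment n.
Proof.
  rewrite !r_nat. destruct (ex_RInt_integrand n) as [v Hv].
  rewrite (is_RInt_unique _ _ _ _ Hv).
  rewrite (is_RInt_unique _ _ _ _ (is_RInt_integrand_succ n v Hv)).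
  unfold increment. ring.
Qed.

Lemma cos_odd_PI2 j : cos ((2 * INR j + 1) * (PI / 2)) = 0.
Proof.
  replace ((2 * INR j + 1) * (PI / 2)) with (INR j * PI + PI / 2) by field.
  rewrite cos_plus, cos_PI2, sin_PI2.
  rewrite (sin_eq_0_1 (INR j * PI)). ring.
  exists (Z.of_nat j). rewrite <- INR_IZR_INZ. reflexivity.
Qed.

(** Integrate [(cos (kx) * radical x)'].  Over the common denominator [radical x]
    its numerator is a combination of [sin ((k+2)x)], [sin (kx)] and
    [sin ((k-2)x)], because [4 - cos^2 x = (7 - cos (2x)) / 2].  As k is odd the
    boundary term at [PI / 2] vanishes; the one at 0 is [sqrt 3]. *)
Lemma sin_int_recurrence j :
  let s k := RInt (fun x => sin (k * x) / radical x) 0 (PI / 2) in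
  let k := 2 * INR j + 1 in
  (k + 1) * s (k + 2) - 14 * k * s k + (k - 1) * s (k - 2) = - 4 * sqrt 3.
Proof.
  intros s k.
  assert (I1 : is_RInt (fun x => (/4 * (k + 1)) * (sin ((k + 2) * x) / radical x)
                          + ((/4 * (- 14 * k)) * (sin (k * x) / radical x)
                            + (/4 * (k - 1)) * (sin ((k - 2) * x) / radical x))) 0 (PI / 2)
      ((/4 * (k + 1)) * s (k + 2) + ((/4 * (- 14 * k)) * s k + (/4 * (k - 1)) * s (k - 2)))).
  { apply is_RInt_add; [|apply is_RInt_add]; apply is_RInt_mul, is_RInt_sin_div_radical. }
  assert (I2 : is_RInt (fun x => (/4 * (k + 1)) * (sin ((k + 2) * x) / radical x)
                          + ((/4 * (- 14 * k)) * (sin (k * x) / radical x)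
                            + (/4 * (k - 1)) * (sin ((k - 2) * x) / radical x))) 0 (PI / 2)
      (cos (k * (PI / 2)) * radical (PI / 2) - cos (k * 0) * radical 0)).
  { apply (is_RInt_antiderivative (fun x => cos (k * x) * radical x)).
    - intros x.
      replace (/ 4 * (k + 1) * (sin ((k + 2) * x) / radical x) +
          (/ 4 * (-14 * k) * (sin (k * x) / radical x) +
           / 4 * (k - 1) * (sin ((k - 2) * x) / radical x)))
       with ((- k * sin (k * x)) * radical x + cos (k * x) * (cos x * sin x / radical x)).
      + apply (is_derive_mult (fun x => cos (k * x)) radical).
        apply is_derive_cos_mul. apply is_derive_radical. intros; apply Rmult_comm.
      + generalize (radical_pos x) (radical_sqr x). intros Hp Hs.
        apply Rmult_eq_reg_r with (radical x); [|lra].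
        field_simplify; [|lra|lra].
        replace (radical x ^ 2) with (4 - cos x ^ 2) by (rewrite <- Hs; ring).
        replace ((k + 2) * x) with (k * x + 2 * x) by ring.
        replace ((k - 2) * x) with (k * x - 2 * x) by ring.
        rewrite sin_plus, sin_minus, sin_2a, cos_2a_cos.
        field.
    - intros x.
      apply continuous_add; [|apply continuous_add]; apply continuous_mul,
        continuous_sin_div_radical. }
  generalize (is_RInt_unique _ _ _ _ I1). rewrite (is_RInt_unique _ _ _ _ I2).
  unfold k at 1. rewrite cos_odd_PI2, Rmult_0_r, cos_0, radical_0.
  intros. lra.
Qed.

(** At [j = 0] the missing predecessor has coefficient 0: the integral of index
    [k - 2 = -1] is multiplied by [k - 1 = 0]. *)
Lemma increment_recurrence j :
  (INR j + 1) * increment (S j) - 7 * (2 * INR j + 1) * increment j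
   + INR j * (match j with O => 0 | S i => increment i end) = - (4 * sqrt 3 / PI).
Proof.
  generalize (sin_int_recurrence j); cbv zeta; intros HE.
  generalize PI_RGT_0; intros Hpi. unfold increment.
  rewrite S_INR.
  replace (2 * (INR j + 1) + 1) with (2 * INR j + 1 + 2) by ring.
  apply Rmult_eq_reg_l with PI; [|lra].
  replace (PI * - (4 * sqrt 3 / PI)) with (- 4 * sqrt 3) by (field; lra).
  rewrite <- HE. destruct j as [|i].
  - simpl INR. field. lra.
  - replace (2 * INR (S i) + 1 - 2) with (2 * INR i + 1) by (rewrite S_INR; ring).
    rewrite S_INR. field. lra.
Qed.

(** The integrand [sin x / sqrt (4 - cos^2 x)] has the antiderivative
    [- asin (cos x / 2)], taken here in the form
    [- atan (cos x / radical x)], where [tan (PI / 6) = 1 / sqrt 3]. *)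
Lemma increment_zero : increment 0 = 1 / 3.
Proof.
  generalize PI_RGT_0 sqrt3_pos; intros Hpi H3. unfold increment. simpl INR.
  assert (HI : is_RInt (fun x => sin ((2 * 0 + 1) * x) / radical x) 0 (PI / 2)
     (- atan (cos (PI / 2) / radical (PI / 2)) - - atan (cos 0 / radical 0))).
  { apply (is_RInt_antiderivative (fun x => - atan (cos x / radical x))).
    - intros x. generalize (radical_pos x) (radical_sqr x); intros HW Hs.
      auto_derive. { split; [apply ex_derive_radical | lra]. }
      change (fun x0 => radical x0) with radical. rewrite Derive_radical.
      replace ((2 * 0 + 1) * x) with x by ring.
      assert (H4 : radical x * radical x + (cos x)^2 = 4) by lra.
      (* The denominator 1 + (cos x / radical x)^2 left by the derivative of atan. *)
      replace (1 + cos x * / radical x * (cos x * / radical x * 1)) 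
        with (4 / (radical x * radical x))
        by (rewrite <- H4; field; lra).
      transitivity (sin x * (radical x * radical x + (cos x)^2) / (4 * radical x)).
      + field. lra.
      + rewrite H4. field. lra.
    - intros x. apply continuous_sin_div_radical. }
  rewrite (is_RInt_unique _ _ _ _ HI). rewrite cos_PI2, cos_0, radical_0.
  rewrite <- tan_PI6, atan_tan by lra.
  replace (0 / radical (PI / 2)) with 0 by (unfold Rdiv; ring). rewrite atan_0.
  field. lra.
Qed.

(** * The recurrence for r and its rational solutions *)

Lemma r_one : r 1 = 1 / 3.
Proof.
  change 1%Z with (Z.of_nat 1). rewrite r_succ. simpl Z.of_nat.
  rewrite r_zero, increment_zero. ring.
Qed.

Lemma r_recurrence n : (2 <= n)%Z ->
      r n = (15 * IZR n - 22) / (IZR n - 1) * r (n - 1)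
            - (15 * IZR n - 23) / (IZR n - 1) * r (n - 2)
            + (IZR n - 2) / (IZR n - 1) * r (n - 3)
            - 4 * sqrt 3 / (PI * (IZR n - 1)).
Proof.
  intros Hn. generalize PI_RGT_0; intros Hpi.
  set (i := Z.to_nat (n - 2)).
  assert (Hi : n = (Z.of_nat i + 2)%Z) by (unfold i; lia). clearbody i. subst n.
  replace (Z.of_nat i + 2)%Z with (Z.of_nat (S (S i))) by lia.
  replace (Z.of_nat (S (S i)) - 1)%Z with (Z.of_nat (S i)) by lia.
  replace (Z.of_nat (S (S i)) - 2)%Z with (Z.of_nat i) by lia.
  rewrite <- INR_IZR_INZ, !r_succ, !S_INR.
  generalize (increment_recurrence i) (pos_INR i). intros HE Hi.
  replace (4 * sqrt 3 / (PI * (INR i + 1 + 1 - 1)))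
    with (4 * sqrt 3 / PI / (INR i + 1)) by (field; lra).
  replace (4 * sqrt 3 / PI) with
    (- ((INR i + 1) * increment (S i) - 7 * (2 * INR i + 1) * increment i +
      INR i * match i with O => 0 | S i0 => increment i0 end)) by (rewrite HE; ring).
  destruct i as [|i].
  - simpl INR. field.
  - replace (Z.of_nat (S (S (S i))) - 3)%Z with (Z.of_nat i) by lia.
    rewrite r_succ. field. lra.
Qed.

(** The index is shifted by one: [rat_seq i c (n + 1)] is the term of index [n],
    so that the three initial indices are -1, 0, 1.  The parameter [i] is the
    term of index 1 and [c] the inhomogeneity. *)
Fixpoint rat_seq (i c : Q) (m : nat) : Q :=
  match m with
  | O => 0%Q
  | S m1 =>
    match m1 with
    | O => 0%Q
    | S m2 =>
      match m2 with
      | O => i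
      | S m3 =>
        let n := (Z.of_nat m3 + 2)%Z in
        (inject_Z (15 * n - 22) / inject_Z (n - 1) * rat_seq i c m1
         - inject_Z (15 * n - 23) / inject_Z (n - 1) * rat_seq i c m2
         + inject_Z (n - 2) / inject_Z (n - 1) * rat_seq i c m3
         - c / inject_Z (n - 1))%Q
      end
    end
  end.

Definition rat_solution (i c : Q) (z : Z) : Q := rat_seq i c (Z.to_nat (z + 1)).

Lemma rat_solution_recurrence i c n : (2 <= n)%Z ->
  rat_solution i c n =
    (inject_Z (15 * n - 22) / inject_Z (n - 1) * rat_solution i c (n - 1)
     - inject_Z (15 * n - 23) / inject_Z (n - 1) * rat_solution i c (n - 2)
     + inject_Z (n - 2) / inject_Z (n - 1) * rat_solution i c (n - 3)
     - c / inject_Z (n - 1))%Q.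
Proof.
  intros Hn. unfold rat_solution.
  set (m := Z.to_nat (n - 2)).
  replace (Z.to_nat (n + 1)) with (S (S (S m))) by lia.
  replace (Z.to_nat (n - 1 + 1)) with (S (S m)) by lia.
  replace (Z.to_nat (n - 2 + 1)) with (S m) by lia.
  replace (Z.to_nat (n - 3 + 1)) with m by lia.
  replace n with (Z.of_nat m + 2)%Z by lia. reflexivity.
Qed.

Lemma Q2R_inject_Z z : Q2R (inject_Z z) = IZR z.
Proof. unfold Q2R. simpl. field. Qed.

Lemma Q2R_rat_solution_recurrence i c n : (2 <= n)%Z ->
  Q2R (rat_solution i c n) =
    (15 * IZR n - 22) / (IZR n - 1) * Q2R (rat_solution i c (n - 1))
    - (15 * IZR n - 23) / (IZR n - 1) * Q2R (rat_solution i c (n - 2))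
    + (IZR n - 2) / (IZR n - 1) * Q2R (rat_solution i c (n - 3))
    - Q2R c / (IZR n - 1).
Proof.
  intros Hn. rewrite rat_solution_recurrence by auto.
  assert (H0 : ~ (inject_Z (n - 1) == 0)%Q).
  { change 0%Q with (inject_Z 0). rewrite inject_Z_injective. lia. }
  rewrite Q2R_minus, Q2R_plus, Q2R_minus, !Q2R_mult, !Q2R_div by auto.
  rewrite !Q2R_inject_Z, !minus_IZR, !mult_IZR. reflexivity.
Qed.

(** The recurrence for [r] is linear with rational coefficients apart from its
    inhomogeneity, a rational multiple of [sqrt 3 / PI], so the two components
    solve it separately. *)
Lemma r_rational_combination n : (-1 <= n)%Z ->
  r n = Q2R (rat_solution (1 # 3) 0 n) + Q2R (rat_solution 0 4 n) * (sqrt 3 / PI).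
Proof.
  generalize PI_RGT_0; intros Hpi Hn.
  set (P z := r z = Q2R (rat_solution (1 # 3) 0 z) + Q2R (rat_solution 0 4 z) * (sqrt 3 / PI)).
  assert (HP : forall m : nat, P (Z.of_nat m - 1)%Z /\ P (Z.of_nat m) /\ P (Z.of_nat m + 1)%Z).
  { induction m as [|m [IH1 [IH2 IH3]]].
    - unfold P, rat_solution; simpl. rewrite r_zero, r_one.
      unfold r; simpl. unfold Q2R; simpl. split; [|split]; field; lra.
    - replace (Z.of_nat (S m) - 1)%Z with (Z.of_nat m) by lia.
      replace (Z.of_nat (S m))%Z with (Z.of_nat m + 1)%Z by lia.
      repeat split; auto.
      set (n' := (Z.of_nat m + 1 + 1)%Z).
      assert (Hn' : (2 <= n')%Z) by lia.
      unfold P. rewrite r_recurrence, (Q2R_rat_solution_recurrence (1 # 3) 0),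
        (Q2R_rat_solution_recurrence 0 4) by auto.
      replace (n' - 1)%Z with (Z.of_nat m + 1)%Z by lia.
      replace (n' - 2)%Z with (Z.of_nat m) by lia.
      replace (n' - 3)%Z with (Z.of_nat m - 1)%Z by lia.
      rewrite IH1, IH2, IH3.
      replace (Q2R 0) with 0 by (unfold Q2R; simpl; field).
      replace (Q2R 4) with 4 by (unfold Q2R; simpl; field).
      apply IZR_le in Hn'. field. lra. }
  destruct (HP (Z.to_nat (n + 1))) as [HP1 _].
  replace (Z.of_nat (Z.to_nat (n + 1)) - 1)%Z with n in HP1 by lia.
  exact HP1.
Qed.

(** * Legendre polynomials at 7 and the hypergeometric sums *)


Lemma pochhammer_front a k : pochhammer a (S k) = a * pochhammer (a + 1) k.
Proof.
  induction k as [|k IH].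
  - simpl. ring.
  - change (pochhammer a (S k) * (a + INR (S k)) =
            a * (pochhammer (a + 1) k * (a + 1 + INR k))).
    rewrite IH, S_INR. ring.
Qed.

Lemma pochhammer_neg_nat m k : (m < k)%nat -> pochhammer (- INR m) k = 0.
Proof.
  induction 1 as [|k _ IH]; simpl.
  - ring.
  - rewrite IH. ring.
Qed.

Lemma pochhammer_one k : pochhammer 1 k = INR (fact k).
Proof.
  induction k as [|k IH]; [reflexivity|].
  change (pochhammer 1 k * (1 + INR k) = INR (S k * fact k)).
  rewrite IH, mult_INR, S_INR. ring.
Qed.

(** This turns the ratio of the parameters 1/2 and 3/2 in the hypergeometric
    series into [1 / (2k + 1)]. *)
Lemma pochhammer_half k :
  pochhammer (3 / 2) k = (2 * INR k + 1) * pochhammer (1 / 2) k.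
Proof.
  induction k as [|k IH].
  - simpl. ring.
  - change (pochhammer (3 / 2) k * (3 / 2 + INR k) =
        (2 * INR (S k) + 1) * (pochhammer (1 / 2) k * (1 / 2 + INR k))).
    rewrite IH, S_INR. field.
Qed.

Lemma pochhammer_pos a k : 0 < a -> 0 < pochhammer a k.
Proof.
  intros Ha. induction k as [|k IH]; simpl; [lra|].
  generalize (pos_INR k). intros. apply Rmult_lt_0_compat; lra.
Qed.

(** Both sides are, up to sign, the product [(x - k) ... x ... (x + k)]: the
    parameters [-n + 1] and [n + 1] of the series give the factors below and
    above [x = n]. *)
Lemma pochhammer_centered x k :
  x * (pochhammer (- x + 1) k * pochhammer (x + 1) k) =
    (-1) ^ k * pochhammer (x - INR k) (S (2 * k)).
Proof.
  induction k as [|k IH].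
  - simpl. ring.
  - replace (S (2 * S k)) with (S (S (S (2 * k)))) by lia.
    rewrite (pochhammer_front (x - INR (S k))).
    change (x * ((pochhammer (- x + 1) k * (- x + 1 + INR k))
        * (pochhammer (x + 1) k * (x + 1 + INR k))) =
      (-1 * (-1) ^ k) * ((x - INR (S k)) * (pochhammer (x - INR (S k) + 1) (S (2 * k))
         * (x - INR (S k) + 1 + INR (S (2 * k)))))).
    rewrite (S_INR (2 * k)), mult_INR; simpl (INR 2); rewrite !S_INR.
    replace (x - (INR k + 1) + 1) with (x - INR k) by ring.
    transitivity ((x * (pochhammer (- x + 1) k * pochhammer (x + 1) k))
        * ((- x + 1 + INR k) * (x + 1 + INR k))); [ring|].
    rewrite IH. ring.
Qed.

(** For natural [x = n] this is [3^k (n + k)! / ((n - k)! k!^2)], the k-th term of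
    the expansion of the Legendre polynomial of degree [n] in powers of [(t - 1) / 2], at
    [t = 7].  Being a polynomial in [x], it vanishes for [k > n] without any
    case distinction. *)
Definition legendre_coef (k : nat) (x : R) : R :=
  3 ^ k / (INR (fact k))^2 * pochhammer (x - INR k + 1) (2 * k).

(** At [x = n] this is the k-th term of [n * H n], by [H_term_legendre], and also
    the sum of [legendre_coef k j] over [j < n]. *)
Definition legendre_sum_coef (k : nat) (x : R) : R :=
  3 ^ k / (INR (fact k))^2 / (2 * INR k + 1) * pochhammer (x - INR k) (S (2 * k)).

Lemma legendre_coef_difference k x :
  legendre_sum_coef k (x + 1) - legendre_sum_coef k x = legendre_coef k x.
Proof.
  unfold legendre_sum_coef, legendre_coef.
  rewrite (pochhammer_front (x - INR k)).
  change (pochhammer (x + 1 - INR k) (S (2 * k))) with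
    (pochhammer (x + 1 - INR k) (2 * k) * (x + 1 - INR k + INR (2 * k))).
  rewrite mult_INR. simpl (INR 2).
  replace (x + 1 - INR k) with (x - INR k + 1) by ring.
  generalize (pos_INR k) (INR_fact_neq_0 k). intros. field. lra.
Qed.

(** The Legendre recurrence at [t = 1 + 2y], compared coefficientwise in y (here
    [y = 3]).  All four products are multiples of one common product of [2k]
    factors, which leaves an identity of polynomials in [x] and [k]. *)
Lemma legendre_coef_recurrence k x :
  x * legendre_coef (S k) x - (2 * x - 1) * legendre_coef (S k) (x - 1)
    + (x - 1) * legendre_coef (S k) (x - 2)
  = 6 * (2 * x - 1) * legendre_coef k (x - 1).
Proof.
  unfold legendre_coef.
  replace (2 * S k)%nat with (S (S (2 * k))) by lia.
  (* The common factor (x - k) (x - k + 1) ... (x + k - 1) of the four products. *)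
  set (m := pochhammer (x - INR k) (2 * k)).
  assert (P0 : pochhammer (x - INR (S k) + 1) (S (S (2 * k)))
               = m * (x + INR k) * (x + INR k + 1)).
  { replace (x - INR (S k) + 1) with (x - INR k) by (rewrite S_INR; ring).
    change (m * (x - INR k + INR (2 * k)) * (x - INR k + INR (S (2 * k)))
       = m * (x + INR k) * (x + INR k + 1)).
    rewrite S_INR, mult_INR. simpl (INR 2). ring. }
  assert (P1 : pochhammer (x - 1 - INR (S k) + 1) (S (S (2 * k)))
               = (x - INR k - 1) * m * (x + INR k)).
  { rewrite pochhammer_front.
    replace (x - 1 - INR (S k) + 1) with (x - INR k - 1) by (rewrite S_INR; ring).
    replace (x - INR k - 1 + 1) with (x - INR k) by ring.
    change ((x - INR k - 1) * (m * (x - INR k + INR (2 * k)))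
       = (x - INR k - 1) * m * (x + INR k)).
    rewrite mult_INR. simpl (INR 2). ring. }
  assert (P2 : pochhammer (x - 2 - INR (S k) + 1) (S (S (2 * k)))
               = (x - INR k - 2) * (x - INR k - 1) * m).
  { rewrite !pochhammer_front.
    replace (x - 2 - INR (S k) + 1) with (x - INR k - 2) by (rewrite S_INR; ring).
    replace (x - INR k - 2 + 1) with (x - INR k - 1) by ring.
    replace (x - INR k - 1 + 1) with (x - INR k) by ring.
    unfold m; ring. }
  rewrite P0, P1, P2.
  replace (x - 1 - INR k + 1) with (x - INR k) by ring. fold m.
  change (fact (S k)) with (S k * fact k)%nat. rewrite mult_INR, S_INR.
  change (3 ^ S k) with (3 * 3 ^ k).
  generalize (pos_INR k) (INR_fact_neq_0 k). intros. field. lra.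
Qed.

(** The sum over [k <= N] telescopes: [legendre_coef_recurrence] turns the term of
    index [k + 1] into a multiple of [legendre_coef k (x - 1)] that cancels what
    the previous terms left.  For natural [x] with
    [1 <= x <= N] the remaining term is zero. *)
Lemma legendre_recurrence_sum N x :
  sum_n (fun k => x * legendre_coef k x - 7 * (2 * x - 1) * legendre_coef k (x - 1)
    + (x - 1) * legendre_coef k (x - 2)) N
  = - 6 * (2 * x - 1) * legendre_coef N (x - 1).
Proof.
  induction N as [|N IH].
  - rewrite sum_O. unfold legendre_coef. simpl. field.
  - rewrite sum_Sn, IH. unfold plus; simpl.
    generalize (legendre_coef_recurrence N x). intros. lra.
Qed.

Lemma sum_n_zero_tail (a : nat -> R) N m :
  (forall k, (N < k)%nat -> a k = 0) -> (N <= m)%nat -> sum_n a m = sum_n a N.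
Proof.
  intros Ha. induction 1 as [|m Hm IH]; [reflexivity|].
  rewrite sum_Sn, IH, (Ha (S m)) by lia. apply (plus_zero_r (G := R_AbelianGroup)).
Qed.

Lemma sum_n_combination a b c (u v w : nat -> R) N :
  sum_n (fun k => a * u k - b * v k + c * w k) N
  = a * sum_n u N - b * sum_n v N + c * sum_n w N.
Proof.
  induction N as [|N IH].
  - rewrite !sum_O. reflexivity.
  - rewrite !sum_Sn, IH. unfold plus; simpl. ring.
Qed.

Lemma Series_zero_tail (a : nat -> R) N :
  (forall k, (N < k)%nat -> a k = 0) -> Series a = sum_n a N.
Proof.
  intros Ha. apply is_series_unique.
  change (is_lim_seq (sum_n a) (sum_n a N)).
  apply (is_lim_seq_ext_loc (fun _ => sum_n a N) (sum_n a)).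
  - exists N. intros n Hn. symmetry. apply sum_n_zero_tail; auto.
  - apply is_lim_seq_const.
Qed.

Definition H_term (n k : nat) : R :=
  (pochhammer (1 / 2) k * pochhammer (- INR n + 1) k * pochhammer (INR n + 1) k)
    / (pochhammer 1 k * pochhammer (3 / 2) k) * ((-3) ^ k / INR (fact k)).

Lemma H_term_zero n k : (S n <= k)%nat -> H_term (S n) k = 0.
Proof.
  intros Hk. unfold H_term.
  replace (- INR (S n) + 1) with (- INR n) by (rewrite S_INR; ring).
  rewrite pochhammer_neg_nat by lia. unfold Rdiv. ring.
Qed.

Lemma H_succ n N : (n <= N)%nat -> H (S n) = sum_n (H_term (S n)) N.
Proof.
  intros Hn. apply (Series_zero_tail (H_term (S n))).
  intros k Hk. apply H_term_zero. lia.
Qed.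

Lemma H_term_legendre n k : INR n * H_term n k = legendre_sum_coef k (INR n).
Proof.
  unfold H_term, legendre_sum_coef.
  rewrite pochhammer_one, pochhammer_half.
  replace ((-3) ^ k) with ((-1) ^ k * 3 ^ k) by (rewrite <- Rpow_mult_distr; f_equal; ring).
  generalize (pos_INR k) (INR_fact_neq_0 k) (pochhammer_pos (1/2) k ltac:(lra))
    (pochhammer_centered (INR n) k). intros Hk Hf Hp Hc.
  assert (Hs : (-1) ^ k * (-1) ^ k = 1) by (rewrite <- Rpow_mult_distr;
     replace (-1 * -1) with 1 by ring; apply pow1).
  transitivity (3 ^ k / INR (fact k) ^ 2 / (2 * INR k + 1) * (-1)^k *
     (INR n * (pochhammer (- INR n + 1) k * pochhammer (INR n + 1) k))).
  - field. repeat split; try lra.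
  - rewrite Hc.
    transitivity (3 ^ k / INR (fact k) ^ 2 / (2 * INR k + 1) * ((-1)^k * (-1) ^ k) *
      pochhammer (INR n - INR k) (S (2 * k))); [ring|].
    rewrite Hs. ring.
Qed.

Definition legendre_sum (n : nat) : R := INR n * H n.

Lemma legendre_sum_0 : legendre_sum 0 = 0.
Proof. unfold legendre_sum. simpl. ring. Qed.

Lemma legendre_sum_eq n N : (n <= S N)%nat ->
  legendre_sum n = sum_n (fun k => legendre_sum_coef k (INR n)) N.
Proof.
  intros Hn. unfold legendre_sum.
  rewrite <- (sum_n_ext (fun k => scal (INR n) (H_term n k)));
    [|intros k; apply H_term_legendre].
  rewrite sum_n_scal_l. destruct n as [|n].
  - simpl INR. rewrite Rmult_0_l. symmetry. apply (scal_zero_l (V := R_ModuleSpace)).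
  - rewrite (H_succ n N) by lia. reflexivity.
Qed.

(** The value at 7 of the Legendre polynomial of degree [n], introduced as a
    difference of the hypergeometric sums; [legendre_eq] gives the usual expansion. *)
Definition legendre (n : nat) : R := legendre_sum (S n) - legendre_sum n.

(** Any bound [N >= n] will do, so that values at neighbouring [n] can be compared
    over one range of summation. *)
Lemma legendre_eq n N : (n <= N)%nat -> legendre n = sum_n (fun k => legendre_coef k (INR n)) N.
Proof.
  intros Hn. unfold legendre. rewrite (legendre_sum_eq (S n) N), (legendre_sum_eq n N) by lia.
  rewrite (sum_n_ext (fun k => legendre_sum_coef k (INR (S n)))
     (fun k => plus (legendre_sum_coef k (INR n)) (legendre_coef k (INR n)))).
  - rewrite sum_n_plus. unfold plus; simpl. ring.
  - intros k. rewrite S_INR, <- legendre_coef_difference. unfold plus; simpl. ring.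
Qed.


Lemma legendre_0 : legendre 0 = 1.
Proof. rewrite (legendre_eq 0 0), sum_O by lia. unfold legendre_coef. simpl. field. Qed.

Lemma legendre_recurrence n :
  INR (S n) * legendre (S n) - 7 * (2 * INR n + 1) * legendre n
   + INR n * (match n with O => 0 | S i => legendre i end) = 0.
Proof.
  (* The range k <= n + 1 covers all three Legendre values, and the term left by
     telescoping is legendre_coef (n + 1) n = 0. *)
  generalize (legendre_recurrence_sum (S n) (INR (S n))).
  replace (legendre_coef (S n) (INR (S n) - 1)) with 0.
  2: { unfold legendre_coef. rewrite S_INR.
       replace (INR n + 1 - 1 - (INR n + 1) + 1) with (- INR 0) by (simpl; ring).
       rewrite pochhammer_neg_nat by lia. ring. }
  rewrite Rmult_0_r. intros HS. etransitivity; [|exact HS]. clear HS.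
  rewrite (legendre_eq (S n) (S n)), (legendre_eq n (S n)) by lia.
  assert (E3 : INR n * match n with 0%nat => 0 | S i => legendre i end =
     INR n * sum_n (fun k => legendre_coef k (INR (S n) - 2)) (S n)).
  { destruct n as [|i]; [simpl INR; ring|]. rewrite (legendre_eq i (S (S i))) by lia.
    do 2 f_equal. apply functional_extensionality. intros k. f_equal.
    rewrite !S_INR. ring. }
  rewrite E3. replace (INR (S n) - 1) with (INR n) by (rewrite S_INR; ring).
  replace (2 * INR (S n) - 1) with (2 * INR n + 1) by (rewrite S_INR; ring).
  symmetry. apply sum_n_combination.
Qed.

(** * Rationality of H *)

Definition is_rational (x : R) : Prop := exists q : Q, x = Q2R q.

Lemma is_rational_IZR z : is_rational (IZR z).
Proof. exists (inject_Z z). symmetry. apply Q2R_inject_Z. Qed.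

Lemma is_rational_INR n : is_rational (INR n).
Proof. rewrite INR_IZR_INZ. apply is_rational_IZR. Qed.

Lemma is_rational_plus x y : is_rational x -> is_rational y -> is_rational (x + y).
Proof. intros [p ->] [q ->]. exists (p + q)%Q. symmetry. apply Q2R_plus. Qed.

Lemma is_rational_mult x y : is_rational x -> is_rational y -> is_rational (x * y).
Proof. intros [p ->] [q ->]. exists (p * q)%Q. symmetry. apply Q2R_mult. Qed.

Lemma is_rational_opp x : is_rational x -> is_rational (- x).
Proof. intros [p ->]. exists (- p)%Q. symmetry. apply Q2R_opp. Qed.

Lemma is_rational_div x y : is_rational x -> is_rational y -> is_rational (x / y).
Proof.
  intros Hx [q ->]. apply is_rational_mult; auto.
  (* Division by zero yields zero, which is rational as well. *)
  destruct (Qeq_dec q 0) as [Hq|Hq].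
  - rewrite (Qeq_eqR _ _ Hq), RMicromega.Q2R_0, Rinv_0. apply is_rational_IZR.
  - exists (/ q)%Q. symmetry. apply Q2R_inv; auto.
Qed.

Lemma is_rational_pow x n : is_rational x -> is_rational (x ^ n).
Proof.
  intros Hx. induction n; simpl.
  - apply is_rational_IZR.
  - apply is_rational_mult; auto.
Qed.

Lemma is_rational_pochhammer x n : is_rational x -> is_rational (pochhammer x n).
Proof.
  intros Hx. induction n; simpl.
  - apply is_rational_IZR.
  - apply is_rational_mult, is_rational_plus; auto using is_rational_INR.
Qed.

Lemma is_rational_sum_n a N :
  (forall k, is_rational (a k)) -> is_rational (sum_n a N).
Proof.
  intros Ha. induction N as [|N IH].
  - rewrite sum_O. apply Ha.
  - rewrite sum_Sn. apply is_rational_plus; auto.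
Qed.

Lemma is_rational_H n : is_rational (H (S n)).
Proof.
  rewrite (H_succ n n) by lia. apply is_rational_sum_n. intros k. unfold H_term.
  auto 12 using is_rational_div, is_rational_mult, is_rational_pow, is_rational_pochhammer,
    is_rational_plus, is_rational_opp, is_rational_INR, is_rational_IZR.
Qed.

(** * Formal power series *)

Definition shift (a : nat -> R) (n : nat) : R :=
  match n with O => 0 | S m => a m end.

(** The Euler operator [z d/dz]. *)
Definition theta (a : nat -> R) (n : nat) : R := INR n * a n.

(** Multiplication by [1 - 14 z + z^2]. *)
Definition mul_disc (a : nat -> R) (n : nat) : R :=
  a n - 14 * shift a n + shift (shift a) n.

(** The Legendre recurrence as an operator on formal series: the coefficient of
    index [n] of the result is
    [n a_n - 7 (2n - 1) a_(n-1) + (n - 1) a_(n-2)]. *)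
Definition legendre_op (a : nat -> R) (n : nat) : R :=
  theta a n - 14 * shift (theta a) n - 7 * shift a n
  + shift (shift (theta a)) n + shift (shift a) n.

Lemma PS_mult_plus_r x y z n :
  PS_mult x (fun k => y k + z k) n = PS_mult x y n + PS_mult x z n.
Proof.
  unfold PS_mult. rewrite <- plus_sum. apply sum_eq. intros. ring.
Qed.

Lemma PS_mult_scal_r x c y n :
  PS_mult x (fun k => c * y k) n = c * PS_mult x y n.
Proof.
  unfold PS_mult. rewrite scal_sum. apply sum_eq. intros. ring.
Qed.

Lemma PS_mult_succ_l x y n :
  PS_mult x y (S n) = x O * y (S n) + PS_mult (fun k => x (S k)) y n.
Proof.
  unfold PS_mult. rewrite decomp_sum by lia. reflexivity.
Qed.

(** With [PS_mult_succ_l], this splits a product by either factor, which makes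
    commutativity an induction on the degree. *)
Lemma PS_mult_succ_r x y n :
  PS_mult x y (S n) = PS_mult x (fun k => y (S k)) n + x (S n) * y O.
Proof.
  unfold PS_mult. rewrite tech5. f_equal.
  - apply sum_eq. intros i Hi. do 2 f_equal. lia.
  - do 2 f_equal. lia.
Qed.

Lemma PS_mult_comm x y n : PS_mult x y n = PS_mult y x n.
Proof.
  revert x y. induction n as [|n IH]; intros x y.
  - unfold PS_mult; simpl. ring.
  - rewrite PS_mult_succ_l, PS_mult_succ_r, IH. ring.
Qed.

Lemma PS_mult_shift_l x y n : PS_mult (shift x) y n = shift (PS_mult x y) n.
Proof.
  destruct n as [|n].
  - unfold PS_mult; simpl. ring.
  - rewrite PS_mult_succ_l. simpl. rewrite Rmult_0_l, Rplus_0_l. reflexivity.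
Qed.

Lemma PS_mult_shift_r x y n : PS_mult x (shift y) n = shift (PS_mult x y) n.
Proof.
  rewrite PS_mult_comm, PS_mult_shift_l. destruct n; simpl; auto. apply PS_mult_comm.
Qed.

Lemma theta_PS_mult x y n :
  theta (PS_mult x y) n = PS_mult (theta x) y n + PS_mult x (theta y) n.
Proof.
  unfold theta, PS_mult. rewrite scal_sum, <- plus_sum. apply sum_eq.
  intros i Hi. rewrite minus_INR by lia. ring.
Qed.

Lemma shift_shift_PS_mult_r x y n :
  PS_mult x (shift (shift y)) n = shift (shift (PS_mult x y)) n.
Proof.
  rewrite PS_mult_shift_r. destruct n; simpl; auto. apply PS_mult_shift_r.
Qed.

Lemma shift_theta_PS_mult x y n :
  shift (theta (PS_mult x y)) n
  = PS_mult (theta x) (shift y) n + PS_mult x (shift (theta y)) n.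
Proof.
  rewrite !PS_mult_shift_r. destruct n; simpl. ring. apply theta_PS_mult.
Qed.

Lemma shift_shift_theta_PS_mult x y n :
  shift (shift (theta (PS_mult x y))) n
  = PS_mult (theta x) (shift (shift y)) n + PS_mult x (shift (shift (theta y))) n.
Proof.
  rewrite !shift_shift_PS_mult_r. destruct n as [|[|n]]; simpl; try ring. apply theta_PS_mult.
Qed.

Lemma PS_mult_mul_disc_expand x y n :
  PS_mult x (mul_disc y) n
  = PS_mult x y n - 14 * PS_mult x (shift y) n + PS_mult x (shift (shift y)) n.
Proof.
  replace (mul_disc y) with (fun k => y k + ((-14) * shift y k + shift (shift y) k))
    by (apply functional_extensionality; intros; unfold mul_disc; ring).
  rewrite !PS_mult_plus_r, PS_mult_scal_r. ring.
Qed.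

Lemma PS_mult_mul_disc x y n : PS_mult x (mul_disc y) n = mul_disc (PS_mult x y) n.
Proof.
  rewrite PS_mult_mul_disc_expand, shift_shift_PS_mult_r, PS_mult_shift_r.
  reflexivity.
Qed.

Lemma PS_mult_legendre_op x y n :
  PS_mult x (legendre_op y) n = PS_mult x (theta y) n - 14 * PS_mult x (shift (theta y)) n
    - 7 * shift (PS_mult x y) n + PS_mult x (shift (shift (theta y))) n
    + shift (shift (PS_mult x y)) n.
Proof.
  replace (legendre_op y) with (fun k => theta y k + ((-14) * shift (theta y) k
     + ((-7) * shift y k + (shift (shift (theta y)) k + shift (shift y) k))))
    by (apply functional_extensionality; intros; unfold legendre_op; ring).
  rewrite !PS_mult_plus_r, !PS_mult_scal_r, (shift_shift_PS_mult_r x y), (PS_mult_shift_r x y).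
  ring.
Qed.

(** The derivation rule for [legendre_op], whose only terms with a derivative are
    [(1 - 14 z + z^2) theta]. *)
Lemma legendre_op_PS_mult x y n : 
  legendre_op (PS_mult x y) n
  = PS_mult x (legendre_op y) n + mul_disc (PS_mult (theta x) y) n.
Proof.
  unfold legendre_op at 1. rewrite theta_PS_mult, shift_theta_PS_mult, shift_shift_theta_PS_mult.
  rewrite PS_mult_legendre_op, <- PS_mult_mul_disc, PS_mult_mul_disc_expand. ring.
Qed.

Lemma legendre_op_legendre n : legendre_op legendre n = 0.
Proof.
  destruct n as [|n].
  - unfold legendre_op, theta; simpl. ring.
  - etransitivity; [|exact (legendre_recurrence n)]. unfold legendre_op, theta.
    destruct n as [|n]; cbn [shift]; cbv beta; rewrite ?S_INR; simpl (INR 0); ring.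
Qed.

Lemma PS_mult_legendre_op_legendre x n : PS_mult x (legendre_op legendre) n = 0.
Proof.
  replace (legendre_op legendre) with (fun k : nat => 0 * legendre k)
    by (apply functional_extensionality; intros; rewrite legendre_op_legendre; ring).
  rewrite PS_mult_scal_r. ring.
Qed.

(** The generating series P is [(1 - 14 z + z^2)^(-1/2)].  From
    [legendre_op P = 0] the derivative of [(1 - 14 z + z^2) P^2] is zero, so
    only its constant coefficient survives. *)
Lemma mul_disc_legendre_sqr n : mul_disc (PS_mult legendre legendre) (S n) = 0.
Proof.
  set (c := PS_mult legendre legendre).
  assert (Hc : forall k, theta c k = 2 * PS_mult legendre (theta legendre) k).
  { intros k. unfold c. rewrite theta_PS_mult, (PS_mult_comm (theta _)). ring. }
  assert (H0 : PS_mult legendre (legendre_op legendre) (S n) = 0).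
  { apply PS_mult_legendre_op_legendre. }
  rewrite PS_mult_legendre_op, shift_shift_PS_mult_r, PS_mult_shift_r in H0. fold c in H0.
  assert (HQ : INR (S n) * mul_disc c (S n) = 0).
  { unfold mul_disc.
    replace (PS_mult legendre (theta legendre)) with (fun k => theta c k / 2) in H0
      by (apply functional_extensionality; intros; rewrite Hc; field).
    unfold theta in H0. destruct n as [|n]; cbn [shift] in *; cbv beta in *;
      rewrite ?S_INR in *; simpl (INR 0) in *; lra. }
  apply Rmult_integral in HQ. destruct HQ as [HQ|HQ]; auto.
  generalize (pos_INR n). rewrite S_INR in HQ. lra.
Qed.

(** The generating series of [legendre_sum] is [z P / (1 - z)], so the left side is
    [z / (1 - z) * (1 - 14 z + z^2) P^2 = z / (1 - z)]. *)
Lemma mul_disc_legendre_sum_legendre n :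
  mul_disc (PS_mult legendre_sum legendre) (S n) = 1.
Proof.
  assert (Hs : forall k, PS_mult legendre_sum legendre (S k) =
     PS_mult legendre_sum legendre k + PS_mult legendre legendre k).
  { intros k. rewrite PS_mult_succ_l, legendre_sum_0, Rmult_0_l, Rplus_0_l.
    rewrite !(PS_mult_comm _ legendre), <- PS_mult_plus_r.
    f_equal. apply functional_extensionality. intros i. unfold legendre. ring. }
  assert (H0 : PS_mult legendre_sum legendre 0 = 0).
  { unfold PS_mult; simpl. rewrite legendre_sum_0. ring. }
  assert (H00 : PS_mult legendre legendre 0 = 1).
  { unfold PS_mult; simpl. rewrite legendre_0. ring. }
  induction n as [|n IH].
  - unfold mul_disc; simpl. rewrite Hs, H0, H00. ring.
  - generalize (mul_disc_legendre_sqr n). revert IH. unfold mul_disc; simpl shift.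
    destruct n as [|n]; simpl shift; rewrite !Hs; intros; lra.
Qed.

(** In degree [n] the operator determines [a_n] from the two previous coefficients,
    its leading factor being [n]. *)
Lemma legendre_op_inj a b :
  a O = b O -> (forall n, legendre_op a (S n) = legendre_op b (S n)) ->
  forall n, a n = b n.
Proof.
  intros H0 HL n.
  assert (HH : a n = b n /\ a (S n) = b (S n)).
  { assert (step : forall m, a m = b m -> shift a m = shift b m -> a (S m) = b (S m)).
    { intros m Em Ep. specialize (HL m). unfold legendre_op, theta in HL. simpl shift in HL.
      apply Rmult_eq_reg_l with (INR (S m)); [|apply not_0_INR; lia].
      rewrite Em in HL. destruct m as [|m]; simpl shift in *; [lra|]. rewrite Ep in HL. lra. }
    induction n as [|n [IH1 IH2]].
    - split; auto.
    - split; auto. }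
  apply HH.
Qed.

(** The value at 0 is set to zero, since [H 0] is a divergent series. *)
Definition H_series : nat -> R := shift (fun n => H (S n)).

Lemma theta_H_series : theta H_series = legendre_sum.
Proof.
  apply functional_extensionality. intros [|n].
  - rewrite legendre_sum_0. unfold theta. simpl. ring.
  - reflexivity.
Qed.

(** Both sides have the same image under [legendre_op], the constant
    [- 4 sqrt 3 / PI] in each positive degree: on the right the Legendre term
    contributes nothing, and the convolution contributes
    [theta H_series * legendre * (1 - 14 z + z^2)]. *)
Lemma increment_closed_form n :
  increment n = 1 / 3 * legendre n - 4 * sqrt 3 / PI * PS_mult H_series legendre n.
Proof.
  revert n. apply legendre_op_inj.
  - rewrite increment_zero, legendre_0. unfold PS_mult; simpl. ring.
  - intros n.
    transitivity (- (4 * sqrt 3 / PI)).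
    + rewrite <- (increment_recurrence n). unfold legendre_op, theta.
      destruct n as [|n]; cbn [shift]; cbv beta; rewrite ?S_INR; simpl (INR 0); ring.
    + transitivity (1 / 3 * legendre_op legendre (S n)
        - 4 * sqrt 3 / PI * legendre_op (PS_mult H_series legendre) (S n)).
      * rewrite legendre_op_legendre, legendre_op_PS_mult, theta_H_series,
          mul_disc_legendre_sum_legendre.
        rewrite PS_mult_legendre_op_legendre. ring.
      * unfold legendre_op, theta. destruct n; simpl shift; ring.
Qed.

(** Summation of [increment_closed_form]: the partial sums of [legendre] are
    [legendre_sum], also inside the convolution. *)
Lemma r_closed_form n :
  r (Z.of_nat n) = INR n / 3 * H n - 4 * sqrt 3 / PI * PS_mult H_series legendre_sum n.
Proof.
  replace (INR n / 3 * H n) with (1 / 3 * legendre_sum n) by (unfold legendre_sum; field).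
  induction n as [|n IH].
  - simpl. rewrite r_zero, legendre_sum_0. unfold PS_mult; simpl. ring.
  - rewrite r_succ, IH, increment_closed_form, PS_mult_succ_r, legendre_sum_0.
    replace (fun k => legendre_sum (S k)) with (fun k => legendre_sum k + legendre k).
    + rewrite PS_mult_plus_r. unfold legendre at 1. ring.
    + apply functional_extensionality. intros k. unfold legendre. ring.
Qed.

Lemma r_convolution n :
  r (Z.of_nat n) = INR n / 3 * H n
     - 4 * sqrt 3 / PI * sum_n_m (fun m => INR (n - m) * H (n - m) * H m) 1 n.
Proof.
  rewrite r_closed_form. do 2 f_equal.
  unfold PS_mult. rewrite <- sum_n_Reals. unfold sum_n.
  rewrite sum_Sn_m by lia.
  rewrite (sum_n_m_ext_loc _ (fun m => INR (n - m) * H (n - m) * H m) 1).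
  - unfold H_series at 1. simpl shift. rewrite Rmult_0_l. apply (plus_zero_l (G := R_AbelianGroup)).
  - intros [|k] Hk; [lia|]. unfold H_series. simpl shift. apply Rmult_comm.
Qed.

(** * Harmonic numbers and the Euler constant *)

Definition harmonic (n : nat) : R := sum_n_m (fun k : nat => / INR k) 1 n.

Lemma harmonic_0 : harmonic 0 = 0.
Proof. unfold harmonic. rewrite sum_n_m_zero by lia. reflexivity. Qed.

Lemma harmonic_succ n : harmonic (S n) = harmonic n + / INR (S n).
Proof.
  unfold harmonic. destruct n as [|n].
  - rewrite sum_n_n, sum_n_m_zero by lia. unfold zero; simpl. ring.
  - rewrite sum_n_Sm by lia. reflexivity.
Qed.

Lemma ln_succ_bounds n : (0 < n)%nat ->
  / INR (S n) <= ln (INR (S n)) - ln (INR n) <= / INR n.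
Proof.
  intros Hn. apply lt_INR in Hn. simpl (INR 0) in Hn.
  assert (HS : 0 < INR (S n)) by (rewrite S_INR; lra).
  assert (Hln : forall x, 0 < x -> ln x <= x - 1).
  { intros x Hx. rewrite <- (ln_exp (x - 1)). apply ln_le; auto.
    generalize (exp_ineq1_le (x - 1)). lra. }
  split.
  - generalize (Hln (INR n / INR (S n)) ltac:(apply Rdiv_lt_0_compat; lra)).
    rewrite ln_div by lra. intros.
    replace (/ INR (S n)) with (1 - INR n / INR (S n)); [lra|].
    rewrite S_INR in *. field. lra.
  - rewrite <- ln_div by lra.
    eapply Rle_trans; [apply Hln, Rdiv_lt_0_compat; lra|].
    right. rewrite S_INR. field. lra.
Qed.

(** The sequences [h_n - ln (n + 1)], increasing, and [h_n - ln n], decreasing,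
    have the same limit and enclose it in an interval of length at most [1 / n]. *)
Lemma euler_gamma_bounds n : (0 < n)%nat ->
  Rabs (harmonic n - ln (INR n) - euler_gamma) <= / INR n.
Proof.
  set (v := fun n => harmonic (S n) - ln (INR (S n))).
  set (u := fun n => harmonic (S n) - ln (INR (S (S n)))).
  assert (Hv : forall n, v (S n) <= v n).
  { intros m. unfold v. rewrite (harmonic_succ (S m)).
    generalize (ln_succ_bounds (S m) ltac:(lia)). lra. }
  assert (Hu : forall n, u n <= u (S n)).
  { intros m. unfold u. rewrite (harmonic_succ (S m)).
    generalize (ln_succ_bounds (S (S m)) ltac:(lia)). lra. }
  assert (Hd : is_lim_seq (fun n => v n - u n) 0).
  { apply is_lim_seq_le_le with (fun _ => 0) (fun m => / INR (S m)).
    - intros m. unfold u, v. generalize (ln_succ_bounds (S m) ltac:(lia)).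
      assert (0 < / INR (S (S m))) by (apply Rinv_0_lt_compat, lt_0_INR; lia). lra.
    - apply is_lim_seq_const.
    - apply (is_lim_seq_incr_1 (fun m => / INR m)).
      replace (Finite 0) with (Rbar_inv p_infty) by reflexivity.
      apply is_lim_seq_inv. apply is_lim_seq_INR. discriminate. }
  destruct (ex_lim_seq_adj u v Hu Hv Hd) as [Eu [Ev Euv]].
  assert (Hg : Lim_seq v = Finite euler_gamma).
  { unfold euler_gamma.
    change (Lim_seq v = Finite (real (Lim_seq (fun n => harmonic n - ln (INR n))))).
    rewrite <- (Lim_seq_incr_1 (fun n => harmonic n - ln (INR n))).
    fold v. destruct Ev as [l Hl]. rewrite (is_lim_seq_unique _ _ Hl). reflexivity. }
  assert (Lv : is_lim_seq v euler_gamma).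
  { rewrite <- Hg. apply Lim_seq_correct. destruct Ev as [l Hl]. exists l; auto. }
  assert (Lu : is_lim_seq u euler_gamma).
  { rewrite <- Hg, <- Euv. apply Lim_seq_correct. destruct Eu as [l Hl]. exists l; auto. }
  intros Hn. destruct n as [|n]; [lia|].
  generalize (is_lim_seq_decr_compare v _ Lv Hv n) (is_lim_seq_incr_compare u _ Lu Hu n).
  unfold u, v. generalize (ln_succ_bounds (S n) Hn). intros.
  apply Rabs_le. lra.
Qed.

(** * Asymptotics of r *)

(** The smooth quotient [(1 / radical x - 1 / sqrt 3) / sin x], with [sin x]
    cancelled by rationalizing the numerator. *)
Definition defect (x : R) : R := - sin x / (sqrt 3 * radical x * (sqrt 3 + radical x)).

Definition defect_deriv (x : R) : R :=
  let d := sqrt 3 * radical x * (sqrt 3 + radical x) in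
  (- cos x * d + sin x * (cos x * sin x / radical x * (3 + 2 * sqrt 3 * radical x))) / (d * d).

Lemma defect_denominator_pos x : 0 < sqrt 3 * radical x * (sqrt 3 + radical x).
Proof.
  generalize sqrt3_pos (radical_pos x). intros. repeat apply Rmult_lt_0_compat; lra.
Qed.

Lemma inv_radical x : / radical x = / sqrt 3 + sin x * defect x.
Proof.
  generalize sqrt3_pos (radical_pos x) (radical_sqr x) sqrt3_sqr (sin2_cos2 x). unfold Rsqr.
  intros H3 HW Hs Hs3 Hsc.
  replace (/ radical x)
    with (/ sqrt 3 + (3 - radical x * radical x) / (sqrt 3 * radical x * (sqrt 3 + radical x))).
  - unfold defect. replace (3 - radical x * radical x) with (- (sin x * sin x)) by lra.
    field. lra.
  - rewrite <- Hs3 at 2. field. lra.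
Qed.

Lemma is_derive_defect x : is_derive defect x (defect_deriv x).
Proof.
  unfold defect, defect_deriv.
  generalize (defect_denominator_pos x) (radical_pos x) sqrt3_sqr sqrt3_pos.
  intros Hd HW H33 H3.
  auto_derive. { repeat split; auto; try apply ex_derive_radical. lra. }
  change (fun x0 => radical x0) with radical. rewrite Derive_radical.
  replace (3 + 2 * sqrt 3 * radical x) with (sqrt 3 * sqrt 3 + 2 * sqrt 3 * radical x) by lra.
  field. lra.
Qed.

Lemma continuous_defect_deriv x : continuous defect_deriv x.
Proof.
  assert (Hs : continuous sin x) by apply continuous_sin.
  assert (Hc : continuous cos x) by apply continuous_cos.
  generalize (continuous_radical x) (defect_denominator_pos x) (radical_pos x); intros HW Hd HWp.
  assert (Hdc : continuous (fun x => sqrt 3 * radical x * (sqrt 3 + radical x)) x).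
  { apply continuous_prod. apply continuous_mul; auto.
    apply continuous_add; auto. apply continuous_const. }
  apply continuous_div.
  - apply continuous_add; apply continuous_prod; auto.
    + apply (continuous_opp cos); auto.
    + apply continuous_prod.
      * apply continuous_div; auto; [|lra]. apply continuous_prod; auto.
      * apply continuous_add. apply continuous_const. apply continuous_mul; auto.
  - apply continuous_prod; auto.
  - assert (0 < sqrt 3 * radical x * (sqrt 3 + radical x)
      * (sqrt 3 * radical x * (sqrt 3 + radical x)))
      by (apply Rmult_lt_0_compat; auto). lra.
Qed.

Lemma continuous_defect x : continuous defect x.
Proof. apply (ex_derive_continuous defect). eexists; apply is_derive_defect. Qed.

(** The antiderivatives of [1 / (sin x * radical x)] and [1 / (sqrt 3 * sin x)]
    have logarithmic singularities at 0 that cancel in the difference; the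
    function [F] below is what remains, regular for [0 <= x <= PI / 2]. *)
Lemma is_RInt_defect : is_RInt defect 0 (PI / 2) (/ sqrt 3 * (ln (sqrt 3) - ln 2)).
Proof.
  generalize PI_RGT_0 sqrt3_pos; intros Hpi H3.
  set (F x := / sqrt 3 * (ln (2 * (1 + cos x)) - ln (radical x + sqrt 3 * cos x))).
  replace (/ sqrt 3 * (ln (sqrt 3) - ln 2)) with (minus (F (PI / 2)) (F 0)).
  - apply (is_RInt_derive F defect); rewrite Rmin_left, Rmax_right by lra; intros x Hx.
    + unfold F, defect.
      assert (Hc : 0 <= cos x) by (apply cos_ge_0; lra).
      generalize (radical_pos x) (radical_sqr x) sqrt3_sqr. intros HW Hs H33.
      assert (Hc3 : 0 < radical x + sqrt 3 * cos x) by nra.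
      auto_derive. { repeat split; auto; try lra. apply ex_derive_radical. }
      change (fun x0 => radical x0) with radical. rewrite Derive_radical.
      field_simplify_eq; [|repeat split; try lra; nra].
      replace (radical x ^ 3) with (radical x * radical x * radical x) by ring.
      rewrite Hs, <- Rsqr_pow2. unfold Rsqr. rewrite H33. ring.
    + apply continuous_defect.
  - unfold F. rewrite cos_PI2, cos_0, radical_0.
    replace (radical (PI / 2)) with 2.
    2: { unfold radical. rewrite cos_PI2. replace (4 - 0 ^ 2) with (2 * 2) by ring.
         rewrite sqrt_square; lra. }
    unfold minus, plus, opp; simpl.
    replace (2 * (1 + 0)) with 2 by ring. replace (2 + sqrt 3 * 0) with 2 by ring.
    replace (2 * (1 + 1)) with (2 * 2) by ring.
    replace (sqrt 3 + sqrt 3 * 1) with (2 * sqrt 3) by ring.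
    rewrite !ln_mult by lra. ring.
Qed.

Definition sin_sqr_defect_int (n : nat) : R :=
  RInt (fun x => sin (INR n * x) ^ 2 * defect x) 0 (PI / 2).

Lemma is_RInt_sin_sqr_defect n :
  is_RInt (fun x => sin (INR n * x) ^ 2 * defect x) 0 (PI / 2) (sin_sqr_defect_int n).
Proof.
  apply is_RInt_continuous. intros x.
  apply continuous_prod; [|apply continuous_defect].
  apply (continuous_ext (fun x => sin (INR n * x) * sin (INR n * x))).
  - intros; simpl. ring.
  - apply continuous_prod; apply continuous_sin_mul.
Qed.

(** Multiplication by [sin x] in [inv_radical] turns [sin ((2n+1)x)] back into a
    difference of squares, so that the second part telescopes. *)
Lemma increment_split n :
  increment n = 2 / PI * (/ sqrt 3 * / (2 * INR n + 1)
    + (sin_sqr_defect_int (S n) - sin_sqr_defect_int n)).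
Proof.
  unfold increment. f_equal. apply is_RInt_unique.
  set (k := 2 * INR n + 1).
  assert (Hk : 0 < k) by (unfold k; generalize (pos_INR n); lra).
  apply is_RInt_ext with (fun x => / sqrt 3 * sin (k * x) +
     (sin (INR (S n) * x) ^ 2 * defect x + -1 * (sin (INR n * x) ^ 2 * defect x))).
  - intros x _. as_R. unfold Rdiv. rewrite inv_radical, S_INR, sin_sqr_succ. fold k. ring.
  - replace (sin_sqr_defect_int (S n) - sin_sqr_defect_int n)
      with (sin_sqr_defect_int (S n) + -1 * sin_sqr_defect_int n) by ring.
    apply is_RInt_add; [|apply is_RInt_add]; [| |apply is_RInt_mul];
      try apply is_RInt_sin_sqr_defect.
    apply is_RInt_mul.
    replace (/ k) with (- / k * cos (k * (PI / 2)) - - / k * cos (k * 0)).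
    + apply (is_RInt_antiderivative (fun x => - / k * cos (k * x))).
      * intros x. auto_derive; auto. field. lra.
      * apply continuous_sin_mul.
    + unfold k at 2. rewrite cos_odd_PI2, !Rmult_0_r, cos_0. ring.
Qed.

(** The reciprocals [1 / (2j + 1)] over [j < n] sum to [harmonic (2n) - harmonic n / 2]. *)
Lemma r_harmonic n :
  r (Z.of_nat n)
  = 2 / PI * (/ sqrt 3 * (harmonic (2 * n) - harmonic n / 2) + sin_sqr_defect_int n).
Proof.
  generalize PI_RGT_0 sqrt3_pos; intros Hpi H3.
  induction n as [|n IH].
  - simpl Z.of_nat. rewrite r_zero.
    change (2 * 0)%nat with 0%nat. rewrite harmonic_0.
    replace (sin_sqr_defect_int 0) with 0; [unfold Rdiv; ring|].
    unfold sin_sqr_defect_int. rewrite (RInt_ext _ (fun _ => 0)).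
    + rewrite RInt_const. unfold scal; simpl; unfold mult; simpl. ring.
    + intros. simpl INR. rewrite Rmult_0_l, sin_0. as_R. ring.
  - rewrite r_succ, IH, increment_split.
    replace (2 * S n)%nat with (S (S (2 * n))) by lia.
    rewrite !harmonic_succ, !S_INR, mult_INR. simpl (INR 2).
    generalize (pos_INR n). intros. field. lra.
Qed.

(** With [sin (nx)^2 = (1 - cos (2nx)) / 2], the deviation from half the integral
    of [defect] is an integral against [cos (2nx)].  Integrating it by parts
    gains the factor [1 / (2n)], and [sin (2nx)] vanishes at both end points. *)
Lemma sin_sqr_defect_int_limit : exists K, forall n, (0 < n)%nat ->
  Rabs (sin_sqr_defect_int n - / 2 * (/ sqrt 3 * (ln (sqrt 3) - ln 2))) <= K * / INR n.
Proof.
  generalize PI_RGT_0; intros Hpi.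
  exists (/ 4 * RInt (fun x => Rabs (defect_deriv x)) 0 (PI / 2)). intros n Hn.
  apply lt_INR in Hn. simpl (INR 0) in Hn.
  set (k := 2 * INR n).
  set (J := RInt (fun x => sin (k * x) * defect_deriv x) 0 (PI / 2)).
  assert (HJ : is_RInt (fun x => sin (k * x) * defect_deriv x) 0 (PI / 2) J).
  { apply is_RInt_continuous. intros x.
    apply continuous_prod. apply continuous_sin_mul. apply continuous_defect_deriv. }
  assert (HI : sin_sqr_defect_int n = / 2 * (/ sqrt 3 * (ln (sqrt 3) - ln 2)) + / (2 * k) * J).
  { apply is_RInt_unique.
    replace (/ 2 * (/ sqrt 3 * (ln (sqrt 3) - ln 2)) + / (2 * k) * J)
      with (/ 2 * (/ sqrt 3 * (ln (sqrt 3) - ln 2)) + (/ (2 * k) * J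
        + (- / (2 * k) * sin (k * (PI / 2)) * defect (PI / 2) - - / (2 * k) * sin (k * 0) * defect 0))).
    - apply is_RInt_ext with (fun x => / 2 * defect x + (/ (2 * k) * (sin (k * x) * defect_deriv x)
          + (- / 2 * cos (k * x) * defect x + - / (2 * k) * sin (k * x) * defect_deriv x))).
      + intros x _. as_R. unfold k. rewrite Rmult_assoc, cos_2a_sin. field. lra.
      + apply is_RInt_add; [apply is_RInt_mul, is_RInt_defect|].
        apply is_RInt_add; [apply is_RInt_mul, HJ|].
        apply (is_RInt_antiderivative (fun x => - / (2 * k) * sin (k * x) * defect x)).
        * intros x. generalize (is_derive_defect x); intros Hg.
          auto_derive. { eexists; apply Hg. }
          replace (Derive (fun y => defect y) x) with (defect_deriv x)
             by (symmetry; apply is_derive_unique, Hg).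
          field. unfold k; lra.
        * intros x. apply continuous_add; apply continuous_prod.
          -- apply continuous_mul, continuous_cos_mul.
          -- apply continuous_defect.
          -- apply continuous_mul, continuous_sin_mul.
          -- apply continuous_defect_deriv.
    - replace (k * (PI / 2)) with (INR n * PI) by (unfold k; field).
      rewrite (sin_eq_0_1 (INR n * PI)), !Rmult_0_r, sin_0. ring.
      exists (Z.of_nat n). rewrite <- INR_IZR_INZ. reflexivity. }
  rewrite HI.
  replace (/ 2 * (/ sqrt 3 * (ln (sqrt 3) - ln 2)) + / (2 * k) * J
      - / 2 * (/ sqrt 3 * (ln (sqrt 3) - ln 2)))
    with (/ (2 * k) * J) by ring.
  rewrite Rabs_mult, Rabs_pos_eq by (left; apply Rinv_0_lt_compat; unfold k; lra).
  replace (/ 4 * RInt (fun x => Rabs (defect_deriv x)) 0 (PI / 2) * / INR n)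
    with (/ (2 * k) * RInt (fun x => Rabs (defect_deriv x)) 0 (PI / 2)) by (unfold k; field; lra).
  apply Rmult_le_compat_l. { left; apply Rinv_0_lt_compat; unfold k; lra. }
  eapply Rle_trans.
  - apply abs_RInt_le. lra. eexists; apply HJ.
  - apply RInt_le. lra.
    + eexists. apply is_RInt_continuous. intros x.
      apply (continuous_comp (fun x => sin (k * x) * defect_deriv x) Rabs).
      apply continuous_prod. apply continuous_sin_mul. apply continuous_defect_deriv.
      apply continuous_Rabs.
    + eexists. apply is_RInt_continuous. intros x.
      apply (continuous_comp defect_deriv Rabs). apply continuous_defect_deriv.
      apply continuous_Rabs.
    + intros x _. rewrite Rabs_mult. rewrite <- (Rmult_1_l (Rabs (defect_deriv x))) at 2.
      apply Rmult_le_compat_r. apply Rabs_pos.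
      generalize (SIN_bound (k * x)). intros. apply Rabs_le. lra.
Qed.

Lemma r_asymptotics :
  is_bigO
    (fun n : nat =>
       r (Z.of_nat n)
       - (1 / (sqrt 3 * PI) * ln (INR n)
          + (euler_gamma + ln (2 * sqrt 3)) / (sqrt 3 * PI)))
    (fun n : nat => / INR n).
Proof.
  generalize PI_RGT_0 sqrt3_pos; intros Hpi H3.
  destruct sin_sqr_defect_int_limit as [K HK].
  exists (2 / PI * (/ sqrt 3 + K)). exists 1%nat. intros n Hn.
  assert (Hn0 : 0 < INR n) by (apply lt_0_INR; lia).
  specialize (HK n Hn).
  generalize (euler_gamma_bounds n Hn) (euler_gamma_bounds (2 * n) ltac:(lia)).
  rewrite r_harmonic, mult_INR. simpl (INR 2). rewrite !ln_mult by lra.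
  (* The three sources of error, each O(1/n). *)
  set (e1 := harmonic n - ln (INR n) - euler_gamma).
  set (e2 := harmonic (2 * n) - (ln (1 + 1) + ln (INR n)) - euler_gamma).
  set (e3 := sin_sqr_defect_int n - / 2 * (/ sqrt 3 * (ln (sqrt 3) - ln 2))) in HK.
  intros H1 H2.
  replace (harmonic n) with (e1 + ln (INR n) + euler_gamma) by (unfold e1; ring).
  replace (harmonic (2 * n))
    with (e2 + (ln (1 + 1) + ln (INR n)) + euler_gamma) by (unfold e2; ring).
  replace (sin_sqr_defect_int n)
    with (e3 + / 2 * (/ sqrt 3 * (ln (sqrt 3) - ln 2))) by (unfold e3; ring).
  replace (1 + 1) with 2 by ring.
  match goal with |- Rabs ?X <= _ => replace X with (2 / PI * (/ sqrt 3 * (e2 - e1 / 2) + e3)) end.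
  2: { field. lra. }
  assert (Hi : 0 < / INR n) by (apply Rinv_0_lt_compat; lra).
  assert (H23 : 0 < 2 / PI) by (apply Rdiv_lt_0_compat; lra).
  assert (Hi3 : 0 < / sqrt 3) by (apply Rinv_0_lt_compat; lra).
  rewrite (Rabs_pos_eq (/ INR n)), Rabs_mult, (Rabs_pos_eq (2 / PI)), Rmult_assoc by lra.
  apply Rmult_le_compat_l; [lra|].
  eapply Rle_trans; [apply Rabs_triang|].
  rewrite Rmult_plus_distr_r. apply Rplus_le_compat; auto.
  rewrite Rabs_mult, (Rabs_pos_eq (/ sqrt 3)) by lra.
  apply Rmult_le_compat_l; [lra|].
  rewrite Rinv_mult in H2.
  apply Rabs_le_between in H1. apply Rabs_le_between in H2. apply Rabs_le. lra.
Qed.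

Theorem proposition5p2 :
  (* (1) *)
  (r (-1) = 0 /\ r 0 = 0 /\ r 1 = 1 / 3 /\
   (forall n : Z, (2 <= n)%Z ->
      r n = (15 * IZR n - 22) / (IZR n - 1) * r (n - 1)
            - (15 * IZR n - 23) / (IZR n - 1) * r (n - 2)
            + (IZR n - 2) / (IZR n - 1) * r (n - 3)
            - 4 * sqrt 3 / (PI * (IZR n - 1))) /\
   (exists a b : Z -> Q,
      (a (-1)%Z == 0 /\ a 0%Z == 0 /\ a 1%Z == 1 # 3)%Q /\
      (b (-1)%Z == 0 /\ b 0%Z == 0 /\ b 1%Z == 0)%Q /\
      (forall n : Z, (2 <= n)%Z ->
         (a n == inject_Z (15 * n - 22) / inject_Z (n - 1) * a (n - 1)%Z
                 - inject_Z (15 * n - 23) / inject_Z (n - 1) * a (n - 2)%Z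
                 + inject_Z (n - 2) / inject_Z (n - 1) * a (n - 3)%Z)%Q /\
         (b n == inject_Z (15 * n - 22) / inject_Z (n - 1) * b (n - 1)%Z
                 - inject_Z (15 * n - 23) / inject_Z (n - 1) * b (n - 2)%Z
                 + inject_Z (n - 2) / inject_Z (n - 1) * b (n - 3)%Z
                 - 4 / inject_Z (n - 1))%Q) /\
      (forall n : Z, (0 <= n)%Z ->
         r n = Q2R (a n) + Q2R (b n) * (sqrt 3 / PI)))) /\
  (* (2) *)
  ((forall n : nat, (1 <= n)%nat -> exists q : Q, H n = Q2R q) /\
   (forall n : nat,
      r (Z.of_nat n) =
        INR n / 3 * H n
        - 4 * sqrt 3 / PI *
          sum_n_m (fun m : nat => INR (n - m) * H (n - m) * H m) 1 n)) /\
  (* (3) *)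
  is_bigO
    (fun n : nat =>
       r (Z.of_nat n)
       - (1 / (sqrt 3 * PI) * ln (INR n)
          + (euler_gamma + ln (2 * sqrt 3)) / (sqrt 3 * PI)))
    (fun n : nat => / INR n).
Proof.
  split; [|split; [split|]].
  - split; [reflexivity|]. split; [apply r_zero|]. split; [apply r_one|].
    split; [apply r_recurrence|].
    exists (rat_solution (1 # 3) 0), (rat_solution 0 4).
    split; [repeat split; reflexivity|]. split; [repeat split; reflexivity|]. split.
    + intros n Hn. split.
      * rewrite (rat_solution_recurrence (1 # 3) 0) at 1 by auto. unfold Qdiv. ring.
      * rewrite (rat_solution_recurrence 0 4) at 1 by auto. reflexivity.
    + intros n Hn. apply r_rational_combination. lia.
  - intros [|n] Hn; [lia|]. apply is_rational_H.
  - apply r_convolution.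
  - apply r_asymptotics.
Qed.
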